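(* Let $(T_k)_{k\ge1}$ be a sequence of continuous linear operators from $\omega$ to $\omega$, write $T_ke_j=(a^{(k)}_{i,j})_{i\ge0}$ for $j\ge0$, let $c^{(k)}_i$ be the smallest index such that $a^{(k)}_{i,j}=0$ for all $j\ge c^{(k)}_i$, and let $f_{k,l}=\max\{c^{(k)}_i:i=0,\dots,l-1\}$ for $k,l\ge1$. If there exist sequences of non-negative integers $(d_k)_{k\ge1}$ and $(N_l)_{l\ge1}$ such that for any $k,l\ge1$ we have $$\mathrm{span}\{(a^{(k)}_{i,j})_{i=0,\dots,l-1}:d_k\le j<f_{k,l}\}=\mathbb{K}^l$$ and, for any $k'\ge k+N_l$, $f_{k,l}\le d_{k'}$, then $(T_k)$ possesses a frequently hypercyclic subspace.
   Context: $\mathbb{K}=\mathbb{R}$ or $\mathbb{C}$; $\omega=\mathbb{K}^{\mathbb{Z}_+}$ (sequences indexed by the non-negative integers) endowed with the product topology; $(e_n)_{n\ge0}$ is its canonical basis. For a continuous linear operator on $\omega$, each row $(a^{(k)}_{i,j})_{j\ge0}$ of its matrix is ultimately zero, so $c^{(k)}_i$ is well defined. A vector $x\in\omega$ is frequently hypercyclic for $(T_k)$ if for any non-empty open set $U\subset\omega$, the set $\{k\ge1:T_kx\in U\}$ has positive lower density. A frequently hypercyclic subspace for $(T_k)$ is a closed infinite-dimensional subspace of $\omega$ in which every non-zero vector is frequently hypercyclic for $(T_k)$. *)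

(* Defs.v *)
From HB Require Import structures.
From mathcomp Require Import all_boot all_order all_algebra.
From mathcomp Require Import all_classical all_reals all_analysis.
From mathcomp Require Import complex.

Set Implicit Arguments.
Unset Strict Implicit.
Unset Printing Implicit Defensive.

Import Order.TTheory GRing.Theory Num.Theory.
Import numFieldNormedType.Exports.

Local Open Scope classical_set_scope.
Local Open Scope ring_scope.

Variant real_or_complex (R : realType) : numFieldType -> Prop :=
| RealScalars : real_or_complex R R
| ComplexScalars : real_or_complex R (complex R).

Definition omega (K : numFieldType) : Type := nat -> K.

HB.instance Definition _ (K : numFieldType) :=
  GRing.Lmodule.copy (omega K) (nat -> K^o).
HB.instance Definition _ (K : numFieldType) :=
  Uniform.copy (omega K) {ptws nat -> K}.

Definition omega_basis (K : numFieldType) (j : nat) : omega K :=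
  fun i => (i == j)%:R.

Definition entry (K : numFieldType) (T : omega K -> omega K) (i j : nat) : K :=
  T (omega_basis K j) i.

(* The least index past which row i vanishes. [xget] returns 0 when there is
   none, which by [row_length_spec] never happens for T linear and continuous. *)
Definition row_length (K : numFieldType) (T : omega K -> omega K) (i : nat) :
    nat :=
  xget 0%N [set c | (forall j, (c <= j)%N -> entry T i j = 0) /\
    forall c', (forall j, (c' <= j)%N -> entry T i j = 0) -> (c <= c')%N].

Lemma nbhs0_omega (K : numFieldType) (A : set (omega K)) :
  nbhs (0 : omega K) A ->
  exists n : nat, forall x : omega K, (forall i, (i < n)%N -> x i = 0) -> A x.
Proof.
pose F : set_system (omega K) :=
  filter_from [set: nat] (fun n => [set x | forall i, (i < n)%N -> x i = 0]).
have FF : Filter F.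
  apply: filter_from_filter; first by exists 0%N.
  move=> m n _ _; exists (maxn m n) => // x xP.
  by split=> i im; apply: xP; rewrite leq_max im ?orbT.
suff cvF : F --> (0 : omega K) by move=> /cvF[n _ nA]; exists n.
apply/cvg_sup => i B.
rewrite nbhsE => -[_ [[C oC <-] C0] CB].
exists i.+1 => // x x0; apply: CB; rewrite /= x0 //.
Qed.

Lemma row_finite (K : numFieldType) (T : {linear omega K -> omega K}) i :
  continuous T -> exists c, forall j, (c <= j)%N -> entry T i j = 0.
Proof.
move=> Tc.
have ci : {for 0, continuous (fun x : omega K => (T x : omega K) i)}.
  apply: (@continuous_comp _ _ _ T (fun x : omega K => x i)); first exact: Tc.
  exact: (@proj_continuous nat (fun=> K) i).
have T0 : (T 0 : omega K) i = 0 by rewrite linear0.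
have : nbhs ((T 0 : omega K) i) [set y : K | `|y| < 1].
  rewrite T0; apply/nbhs_ballP; exists 1 => //= y.
  by rewrite /ball/= sub0r normrN.
move=> /ci /nbhs0_omega [n nP].
exists n => j nj; apply/eqP; case: (eqVneq (entry T i j) 0) => // anz'.
have e1 : (T ((entry T i j)^-1 *: omega_basis K j) : omega K) i = 1.
  rewrite linearZ; change ((entry T i j)^-1 * entry T i j = 1); exact: mulVf.
suff: `|1 : K| < 1 by rewrite normr1 ltxx.
rewrite -[X in `|X|]e1; apply: nP => m mn.
rewrite /GRing.scale/= /omega_basis.
by rewrite (ltn_eqF (leq_trans mn nj)); exact: mulr0.
Qed.

Lemma row_length_spec (K : numFieldType) (T : {linear omega K -> omega K}) i :
  continuous T ->
  (forall j, (row_length T i <= j)%N -> entry T i j = 0) /\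
  forall c, (forall j, (c <= j)%N -> entry T i j = 0) ->
    (row_length T i <= c)%N.
Proof.
move=> /(row_finite i)[c cP].
have ex : exists n, `[< forall j, (n <= j)%N -> entry T i j = 0 >].
  by exists c; apply/asboolP.
have [m /asboolP mP mmin] := ex_minnP ex.
rewrite /row_length.
case: xgetP => [_ -> []//|/(_ m) []]; split=> // c' c'P.
by apply: mmin; apply/asboolP.
Qed.

Definition max_row_length (K : numFieldType) (T : omega K -> omega K)
    (l : nat) : nat :=
  \max_(i < l) row_length T i.

(* lim inf of #(A `&` [1, n]) / n; the value at n = 0 is irrelevant. *)
Definition lower_density (R : realType) (A : set nat) : \bar R :=
  limn_einf (fun n => ((\sum_(1 <= k < n.+1) (k \in A))%N%:R / n%:R)%:E).

Definition frequently_hypercyclic (R : realType) (K : numFieldType)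
    (T : nat -> omega K -> omega K) (x : omega K) : Prop :=
  forall U : set (omega K), open U -> U !=set0 ->
    (0 < lower_density R [set k | (1 <= k)%N /\ U (T k x)])%E.

(* M is contained in no finitely spanned subspace; for M a linear subspace this
   says that M has no finite spanning family. *)
Definition infinite_dimensional (K : numFieldType) (V : lmodType K)
    (M : set V) : Prop :=
  forall (n : nat) (v : 'I_n -> V),
    ~ (M `<=` [set \sum_(i < n) a i *: v i | a in [set: 'I_n -> K]]).

Definition frequently_hypercyclic_subspace (R : realType) (K : numFieldType)
    (T : nat -> omega K -> omega K) (M : set (omega K)) : Prop :=
  [/\ GRing.submod_closed [in M], closed M, infinite_dimensional M &
      forall x, M x -> x <> 0 -> frequently_hypercyclic R T x].

(* Main.v *)
Require Import Defs.
From mathcomp Require Import all_boot all_order all_algebra.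
From mathcomp Require Import all_classical all_reals all_analysis.
From mathcomp Require Import complex zify.
Import Order.TTheory GRing.Theory Num.Theory.
Import numFieldNormedType.Exports.

Local Open Scope classical_set_scope.
Local Open Scope ring_scope.

Set Implicit Arguments.
Unset Strict Implicit.
Unset Printing Implicit Defensive.

(** Let f_(k,l) be the number of columns that matter for the first l coordinates
    of T_k x. On the window of indices [d_k, f_(k,l)) the span condition says
    that, whatever the earlier coordinates of x are, the window can be filled so
    that the first l coordinates of T_k x are any prescribed ones. The separation
    condition makes the windows of two times k < k' disjoint and consecutive as
    soon as k + N_l <= k'. So if times are scheduled far enough apart, infinitely
    many such prescriptions can be met one after the other, and exactly.

    Exactness makes a closed subspace possible. A task is a pair of an index n
    and a finite vector y of scalars from a fixed dense sequence. The subspace M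
    consists of vectors x such that, at each time k scheduled for the task (n, y),
    the first coordinates of T_k x are a_n(x) y, where a_n(x) is the first
    coordinate of T_k x at one fixed time k scheduled for the task (n, (1)).
    These are continuous linear equations, so M is closed, and
    the scalars a_n(x) may be chosen freely, so M is infinite-dimensional. If some
    a_n(x) is nonzero, the vectors a_n(x) y approximate every target, and x is
    frequently hypercyclic provided that each task is scheduled with positive
    lower density. It remains to exclude x <> 0 with all a_n(x) = 0, which is done
    by working inside a closed subspace X of omega on which the family of all
    prescribed coordinates determines x and is arbitrary
    ([interpolation_subspace]): inside each window, X only keeps the range of a
    linear right inverse of the corresponding block of T_k, and it is zero outside
    the windows.

    The schedule ([separated_progressions]) is 2-adic. Visit the integers m >= 1
    in order, and after m wait for 1 + v_2(m) units of time. As the sum of v_2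
    over 1..m is at most m, the time of m is at most 2m; integers of a given
    valuation v have density 2^-(v+1), hence positive lower density in time, and
    they are followed by a gap larger than v. A task that needs a gap W is
    attached to a valuation v >= W. *)

(** * A schedule with prescribed gaps and positive densities *)

Lemma logn2_fact_leq m : (logn 2 m`! <= m)%N.
Proof.
rewrite logn_fact//.
(* With the term m %/ 2 ^ n added, the bound is inductive: twice the next
   summand is at most this term. *)
suff: forall n, (\sum_(1 <= k < n.+1) m %/ 2 ^ k + m %/ 2 ^ n <= m)%N.
  by move=> /(_ m); apply: leq_trans; exact: leq_addr.
elim=> [|n IH]; first by rewrite big_geq// divn1.
rewrite big_nat_recr//= expnSr divnMA; apply: leq_trans IH.
by rewrite -addnA leq_add2l addnn -muln2 leq_divM.
Qed.

(** The time at which m is visited when the visit of each j >= 1 is followed by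
    a pause of 1 + v_2(j), the visit of 1 taking place at time 1. *)
Definition spread (m : nat) : nat := (m + logn 2 m.-1`!)%N.

Lemma spreadS m : (0 < m)%N -> spread m.+1 = (spread m + (logn 2 m).+1)%N.
Proof.
by case: m => // m _; rewrite /spread/= factS lognM ?fact_gt0//; lia.
Qed.

Lemma ltn_spread m n : (0 < m)%N -> (m < n)%N ->
  (spread m + logn 2 m < spread n)%N.
Proof.
move=> m0; elim: n => // n IH; rewrite ltnS leq_eqVlt => /predU1P[<-|mn].
  by rewrite spreadS// addnS.
rewrite spreadS ?(leq_trans _ mn)//.
exact: leq_trans (IH mn) (leq_addr _ _).
Qed.

(** [h p s] is the s-th time scheduled for the p-th task, and [W p] the gap that
    must follow each of these times. Attaching to p a 2-adic valuation that is at
    least [W p] provides the gap; this makes the constant C of the linear bound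
    on [h p] large, but does not prevent such a bound. *)
Lemma separated_progressions (W : nat -> nat) :
  exists h : nat -> nat -> nat,
  [/\ forall p s, (0 < h p s)%N,
      forall p, exists C, forall s, (h p s <= C * s.+1)%N,
      forall p q s t, h p s = h q t -> p = q /\ s = t
    & forall p q s t, (h p s < h q t)%N -> (h p s + W p <= h q t)%N].
Proof.
(* g p is the 2-adic valuation attached to p: partial sums make it injective,
   whatever W is. *)
pose g p := (p + \sum_(i < p.+1) W i)%N.
have g_inj : injective g.
  move=> p q; wlog pq : p q / (p <= q)%N.
    by move=> H; have [/H//|/ltnW/H{}H /esym/H] := leqP p q.
  rewrite /g -!(big_mkord xpredT W) => e; apply/eqP; rewrite eqn_leq pq/=.
  by move: e; rewrite (@big_cat_nat _ _ _ p.+1 0 q.+1)//=; lia.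
have Wg p : (W p <= g p)%N by rewrite /g big_ord_recr/=; lia.
pose m p s := (2 ^ g p * (s.*2.+1))%N.
have m0 p s : (0 < m p s)%N by rewrite muln_gt0 expn_gt0.
have vm p s : logn 2 (m p s) = g p.
  by rewrite lognM ?expn_gt0// pfactorK// lognE/= dvdn2/= odd_double/= addn0.
exists (fun p s => spread (m p s)); split.
- by move=> p s; rewrite addn_gt0 m0.
- move=> p; exists (2 ^ (g p).+2)%N => s.
  have := logn2_fact_leq (m p s).-1; rewrite /spread.
  have -> : (2 ^ (g p).+2 * s.+1 = (m p s).*2 + (2 ^ g p).*2)%N.
    by rewrite /m !expnS; nia.
  lia.
- move=> p q s t e.
  have em : m p s = m q t.
    have [/ltn_spread|/ltn_spread|//] := ltngtP (m p s) (m q t).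
    + by move=> /(_ (m0 _ _)); lia.
    + by move=> /(_ (m0 _ _)); lia.
  have pq : p = q by apply: g_inj; rewrite -(vm p s) em vm.
  split=> //; move: em; rewrite pq /m => /eqP.
  by rewrite eqn_pmul2l ?expn_gt0// => /eqP[]; lia.
- move=> p q s t lt.
  have mlt : (m p s < m q t)%N.
    rewrite ltnNge; apply/negP; rewrite leq_eqVlt => /predU1P[e|].
      by move: lt; rewrite e ltnn.
    by move=> /ltn_spread => /(_ (m0 _ _)); lia.
  have := ltn_spread (m0 p s) mlt; rewrite vm; have := Wg p; lia.
Qed.

(** Among the first n integers there are at least floor(n / C) values of [h],
    and floor(n / C) >= n / 2C once n >= C. *)
Lemma lower_density_gt0 (R : realType) (A : set nat) (h : nat -> nat) (C : nat) :
  injective h -> (forall s, 0 < h s <= C * s.+1)%N -> (forall s, A (h s)) ->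
  (0 < lower_density R A)%E.
Proof.
move=> h_inj h_bd hA.
have C0 : (0 < C)%N by have /andP[] := h_bd 0%N; lia.
have card n : (n %/ C <= \sum_(1 <= k < n.+1) (k \in A))%N.
  have -> : (\sum_(1 <= k < n.+1) (k \in A))%N
          = size [seq k <- index_iota 1 n.+1 | k \in A].
    by rewrite -sum1_size big_filter [RHS]big_mkcond/=;
      apply: eq_bigr => k _; case: (k \in A).
  rewrite -[X in (X <= _)%N](size_iota 0) -(size_map h).
  apply: uniq_leq_size; first by rewrite map_inj_uniq// iota_uniq.
  move=> _ /mapP[s + ->]; rewrite mem_iota add0n /= => sn.
  rewrite mem_filter mem_set//= mem_index_iota ltnS.
  have /andP[-> hs]/= := h_bd s; apply: leq_trans hs _.
  by apply: leq_trans (leq_divM n C); rewrite mulnC leq_mul2r sn orbT.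
rewrite /lower_density limn_einf_lim.
apply: (@lt_le_trans _ _ ((2 * C)%:R^-1 : R)%:E).
  by rewrite lte_fin invr_gt0 ltr0n muln_gt0.
apply: lime_ge; first exact: is_cvg_einfs.
exists C => // m /= Cm.
apply: le_ereal_inf_tmp => _ [n /= mn <-].
have Cn : (C <= n)%N := leq_trans Cm mn.
rewrite lee_fin ler_pdivlMr ?ltr0n ?(leq_trans C0)//.
rewrite mulrC ler_pdivrMr ?ltr0n ?muln_gt0// -natrM ler_nat.
apply: (@leq_trans (n %/ C * (2 * C))); last by rewrite leq_mul2r card orbT.
have := divn_eq n C; have := ltn_pmod n C0.
have : (0 < n %/ C)%N by rewrite divn_gt0.
nia.
Qed.

(** * Dense sequences of scalars and the topology of omega *)

(** The value 1 is put in the sequence so that it can serve as a target from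
    which the multiplier of a vector is read off. *)
Lemma dense_sequence (R : realType) (K : numFieldType) :
  real_or_complex R K ->
  exists D : nat -> K, D 0%N = 1 /\
    forall z e, 0 < e -> exists n, `|z - D n| < e.
Proof.
move=> hK.
suff [Q [f fP]] : exists (Q : countType) (f : Q -> K),
    forall z e, 0 < e -> exists q, `|z - f q| < e.
  exists (fun n => if n is m.+1 then oapp f 1 (unpickle m) else 1); split=> //.
  move=> z e /(fP z)[q qP]; exists (pickle q).+1.
  by rewrite pickleK.
have ratP (z e : R) : 0 < e -> exists q : rat, `|z - ratr q| < e.
  move=> e0; have : z - e < z + e by rewrite ltrD2l gt0_cp.
  by move=> /rat_in_itvoo[q]; rewrite in_itv/= -ltr_distl distrC => ?; exists q.
case: hK; first by exists rat, ratr; exact: ratP.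
exists (rat * rat)%type, (fun q => Complex (ratr q.1) (ratr q.2)).
move=> [a b] [e e']; rewrite ltcE/= => /andP[/eqP -> e0].
have e20 : 0 < e / 2 by rewrite divr_gt0.
have [[q qP] [r rP]] := (ratP a _ e20, ratP b _ e20).
exists (q, r); rewrite normc_def ltcR/= -ltr_sqr ?nnegrE ?sqrtr_ge0 ?(ltW e0)//.
rewrite sqr_sqrtr ?addr_ge0 ?sqr_ge0//.
rewrite -(real_normK (num_real (a - _))) -(real_normK (num_real (b - _))).
set u := `|_|; set v := `|_|.
have [u0 v0] : 0 <= u /\ 0 <= v by rewrite !normr_ge0.
apply: (@le_lt_trans _ _ ((u + v) ^+ 2)).
  by rewrite sqrrD lerD2r lerDl mulrn_wge0// mulr_ge0.
rewrite ltr_sqr ?nnegrE ?addr_ge0 ?(ltW e0)//.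
by rewrite (splitr e) ltrD.
Qed.

Section Omega.
Variable K : numFieldType.
Implicit Types (x u : omega K) (U : set (omega K)).

Lemma coordinate_continuous i : continuous (fun x : omega K => x i).
Proof. exact: (@proj_continuous nat (fun=> K) i). Qed.

Lemma open_omega_cylinder U u : open U -> U u ->
  exists l e, 0 < e /\
    forall x, (forall i, (i < l)%N -> `|x i - u i| < e) -> U x.
Proof.
move=> oU Uu.
pose F : set_system (omega K) := filter_from [set p : nat * K | 0 < p.2]
  (fun p => [set x | forall i, (i < p.1)%N -> `|x i - u i| < p.2]).
have FF : Filter F.
  apply: filter_from_filter; first by exists (0%N, 1) => /=.
  move=> [l e] [l' e'] /= e0 e'0.
  have ce : e >=< e' by apply: real_comparable; exact: gtr0_real.
  exists (maxn l l', Order.min e e') => /=; first by rewrite comparable_lt_min ?e0.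
  move=> x xP; split=> i il; have := xP i; rewrite leq_max il ?orbT => /(_ isT);
    by rewrite comparable_lt_min// => /andP[].
suff cvF : F --> (u : omega K).
  have /cvF[[l e] e0 /= leU] : nbhs u U by exact: open_nbhs_nbhs.
  by exists l, e.
apply/cvg_sup => i B; rewrite nbhsE => -[_ [[C oC <-] Cu] CB].
have /nbhs_ballP[e /= e0 eC] : nbhs (u i) C by exact: open_nbhs_nbhs.
exists (i.+1, e) => // x /(_ i (ltnSn i)) xu; apply: CB => /=.
by apply: eC; rewrite /ball /= distrC.
Qed.

(** A continuous functional on omega that vanishes on the basis vectors of index
    at least c only sees the first c coordinates: by continuity at 0 it is
    bounded by 1, hence zero by homogeneity, on the vectors that vanish up to
    some n, and between c and n there are finitely many coordinates. *)
Lemma row_sum (T : {linear omega K -> omega K}) i c x :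
  continuous T -> (row_length T i <= c)%N ->
  T x i = \sum_(j < c) entry T i j * x j.
Proof.
move=> Tc rc.
have [n tail0] : exists n, forall x, (forall j, (j < n)%N -> x j = 0) -> T x i = 0.
  have ci : {for 0, continuous (fun x : omega K => (T x : omega K) i)}.
    apply: (@continuous_comp _ _ _ T (fun x : omega K => x i)); first exact: Tc.
    exact: coordinate_continuous.
  have : nbhs ((T 0 : omega K) i) [set y : K | `|y| < 1].
    rewrite linear0; apply/nbhs_ballP; exists 1 => //= y.
    by rewrite /ball/= sub0r normrN.
  move=> /ci /nbhs0_omega [n nP]; exists n => {}x x0.
  apply/eqP; apply: contraT => Tx0.
  have /nP /= : forall j, (j < n)%N -> ((T x i)^-1 *: x) j = 0.
    by move=> j /x0 xj; rewrite /GRing.scale/= xj; exact: mulr0.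
  rewrite linearZ; change (`|(T x i)^-1 * T x i| < 1 -> false).
  by rewrite mulVf// normr1 ltxx.
have basis m : T (\sum_(j < m) x j *: omega_basis K j) i
    = \sum_(j < m) entry T i j * x j.
  elim: m => [|m IH]; first by rewrite !big_ord0 linear0.
  rewrite !big_ord_recr/= linearD linearZ/=.
  by rewrite -IH mulrC.
have coord m j : (\sum_(j < m) x j *: omega_basis K j : omega K) j
    = if (j < m)%N then x j else 0.
  elim: m => [|m IH]; first by rewrite big_ord0.
  rewrite big_ord_recr/= ltnS leq_eqVlt.
  transitivity ((if (j < m)%N then x j else 0) + x m * (j == m)%:R).
    by rewrite -IH.
  by case: (ltngtP j m) => [_|_|->]; rewrite /= ?mulr0 ?mulr1 ?addr0 ?add0r.
pose m := maxn n c.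
transitivity (T (\sum_(j < m) x j *: omega_basis K j) i).
  apply/eqP; rewrite -subr_eq0; apply/eqP.
  transitivity (T (x - \sum_(j < m) x j *: omega_basis K j) i).
    by rewrite linearB.
  apply: tail0 => j jn.
  transitivity (x j - (\sum_(j < m) x j *: omega_basis K j : omega K) j) => //.
  by rewrite coord /m leq_max jn subrr.
rewrite basis -!(big_mkord xpredT (fun j => entry T i j * x j)).
rewrite (@big_cat_nat _ _ _ c)//= ?leq_maxr//.
rewrite [X in _ + X]big_nat_cond [X in _ + X]big1 ?addr0// => j /andP[/andP[cj _] _].
by rewrite ((row_length_spec i Tc).1 j (leq_trans rc cj)) mul0r.
Qed.

End Omega.

Lemma closed_equation (K : numFieldType) (X : topologicalType) (f g : X -> K) :
  continuous f -> continuous g -> closed [set x | f x = g x].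
Proof.
move=> fc gc.
have -> : [set x | f x = g x] = (fun x => f x - g x) @^-1` [set 0].
  by apply/seteqP; split=> x /= => [->|/eqP]; rewrite ?subrr// subr_eq0 => /eqP.
apply: closed_comp => [x _|].
  by apply: (@continuousB K K^o X); [exact: fc|exact: gc].
by apply/accessible_closed_set1/hausdorff_accessible/norm_hausdorff.
Qed.

Lemma closed_forall (X : topologicalType) (I : Type) (P : I -> set X) :
  (forall i, closed (P i)) -> closed [set x | forall i, P i x].
Proof.
move=> Pc; have -> : [set x | forall i, P i x] = \bigcap_(i in setT) P i.
  by apply/seteqP; split=> x /= => [h i _|h i]; exact: h.
exact: closed_bigI.
Qed.

Lemma closed_implies (X : topologicalType) (Q : Prop) (P : set X) :
  closed P -> closed [set x | Q -> P x].
Proof.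
move=> Pc; have [q|nq] := pselect Q.
  have -> // : [set x | Q -> P x] = P.
  by apply/seteqP; split=> x /= => [/(_ q)|].
have -> : [set x | Q -> P x] = setT by apply/seteqP; split=> x //= _ /nq.
exact: closedT.
Qed.

Lemma continuous_bigsum (K : numFieldType) (X : topologicalType) (I : Type)
    (s : seq I) (f : I -> X -> K) :
  (forall i, continuous (f i)) -> continuous (fun x => \sum_(i <- s) f i x).
Proof.
move=> fc; elim: s => [|i s IH].
  by under eq_fun do rewrite big_nil; exact: cst_continuous.
under eq_fun do rewrite big_cons.
by move=> x; apply: (@continuousD K K^o X); [exact: fc|exact: IH].
Qed.

Lemma continuous_scale (K : numFieldType) (X : topologicalType) (c : K) (f : X -> K) :
  continuous f -> continuous (fun x => c * f x).
Proof.
by move=> fc x; apply: (@continuousM K X); [exact: cst_continuous|exact: fc].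
Qed.

(** * Solving systems window by window *)

Lemma triangular_system (A : Type) (x0 : A) (E : nat -> (nat -> A) -> A) :
  (forall j x y, (forall i, (i < j)%N -> x i = y i) -> E j x = E j y) ->
  exists x : nat -> A, forall j, x j = E j x.
Proof.
move=> E_tri.
pose next s := rcons s (E (size s) (nth x0 s)).
pose pre n := iter n next [::].
have size_pre n : size (pre n) = n.
  by elim: n => // n IH; rewrite /pre/= -/(pre n) size_rcons IH.
have nth_pre n j : (j < n)%N -> nth x0 (pre n) j = nth x0 (pre j.+1) j.
  elim: n => // n IH; rewrite ltnS leq_eqVlt => /predU1P[->//|jn].
  by rewrite /pre/= -/(pre n) nth_rcons size_pre jn IH.
exists (fun j => nth x0 (pre j.+1) j) => j.
rewrite /pre/= -/(pre j) nth_rcons size_pre ltnn eqxx.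
by apply: E_tri => i; exact: nth_pre.
Qed.

Lemma span_map_uniq (F : fieldType) (V : vectType F) (C : nat -> V) (s : seq nat) v :
  uniq s -> v \in <<[seq C j | j <- s]>>%VS ->
  exists r : nat -> F, v = \sum_(j <- s) r j *: C j.
Proof.
elim: s v => [|n s IH] v /=.
  by move=> _; rewrite span_nil memv0 => /eqP ->; exists (fun=> 0); rewrite big_nil.
move=> /andP[ns us]; rewrite span_cons => /memv_addP[_ /vlineP[c ->]] [w ws ->].
have [r ->] := IH w us ws.
exists (fun j => if j == n then c else r j); rewrite big_cons eqxx; congr (_ + _).
by apply: eq_big_seq => j js; case: eqP => // e; rewrite -e js in ns.
Qed.

(** The coefficients r form a right inverse of the block of A with columns in
    [a, b), since each vector of the standard basis is a combination of these
    columns. *)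
Lemma full_span_inverse (F : fieldType) (A : nat -> nat -> F) l a b :
  <<[seq \col_(i < l) A i j | j <- index_iota a b]>>%VS
    = fullv :> {vspace 'cV[F]_l} ->
  exists r : nat -> nat -> F, forall i i', (i < l)%N -> (i' < l)%N ->
    \sum_(a <= j < b) A i' j * r i j = (i' == i)%:R.
Proof.
move=> full.
have /choice[r rP] : forall i, exists r : nat -> F, forall i', (i < l)%N ->
    (i' < l)%N -> \sum_(a <= j < b) A i' j * r j = (i' == i)%:R.
  move=> i; have [il|] := ltnP i l; last by exists (fun=> 0) => i'; lia.
  have : delta_mx (Ordinal il) ord0 \in
      <<[seq \col_(i < l) A i j | j <- index_iota a b]>>%VS.
    by rewrite full memvf.
  move=> /(span_map_uniq (iota_uniq _ _))[r rE]; exists r => i' _ i'l.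
  have /matrixP/(_ (Ordinal i'l) ord0) := rE.
  rewrite mxE eqxx andbT summxE => /esym.
  under eq_bigr do rewrite !mxE mulrC.
  by [].
by exists r => i i'; exact: rP.
Qed.

(** At the times k in S the first [L k] coordinates of [T k x] are to be
    prescribed; they depend on the coordinates of x below [b k], those in the
    window [a k, b k) being steered by the right inverse [r k]. *)
Section Interpolation.
Variables (K : numFieldType) (T : nat -> {linear omega K -> omega K}).
Variables (S : set nat) (a b L : nat -> nat) (r : nat -> nat -> nat -> K).
Hypothesis T_cont : forall k, S k -> continuous (T k).
Hypothesis row_leq : forall k i, S k -> (i < L k)%N -> (row_length (T k) i <= b k)%N.
Hypothesis windows : forall k k', S k -> S k' -> (k < k')%N -> (b k <= a k')%N.
Hypothesis rP : forall k i i', S k -> (i < L k)%N -> (i' < L k)%N ->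
  \sum_(a k <= j < b k) entry (T k) i' j * r k i j = (i' == i)%:R.

Let window k j := S k /\ (a k <= j < b k)%N.

Let window_inj k k' j : window k j -> window k' j -> k = k'.
Proof.
move=> [Sk /andP[akj jbk]] [Sk' /andP[akj' jbk']].
have [/windows|/windows|//] := ltngtP k k'.
- by move=> /(_ Sk Sk') ?; exfalso; lia.
- by move=> /(_ Sk' Sk) ?; exfalso; lia.
Qed.

Let split_row x k i : S k -> (i < L k)%N ->
  T k x i = \sum_(0 <= j < a k) entry (T k) i j * x j
    + \sum_(a k <= j < b k) entry (T k) i j * x j.
Proof.
move=> Sk iL.
have ab : (a k <= b k)%N.
  rewrite leqNgt; apply/negP => ba; have := rP Sk iL iL.
  rewrite big_geq ?(ltnW ba)// eqxx => /eqP.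
  by rewrite eq_sym oner_eq0.
rewrite (row_sum x (T_cont Sk) (row_leq Sk iL)).
by rewrite -(big_mkord xpredT (fun j => entry (T k) i j * x j))
  (@big_cat_nat _ _ _ (a k)).
Qed.

(** With B_k the block of T_k on its window and R_k its right inverse, the first
    condition reads x = R_k B_k x on the window: the restriction of x lies in the
    range of R_k, which is a complement of the kernel of B_k. *)
Definition window_vectors : set (omega K) := [set x |
  (forall k j, window k j -> x j = \sum_(i < L k) r k i j *
     \sum_(a k <= m < b k) entry (T k) i m * x m)
  /\ forall j, (forall k, ~ window k j) -> x j = 0].

Lemma window_vectors_closed : closed window_vectors.
Proof.
apply: closedI; do ?[apply: closed_forall => ?]; do ?apply: closed_implies.
  apply: closed_equation; first exact: coordinate_continuous.
  apply: continuous_bigsum => i; apply: continuous_scale.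
  apply: continuous_bigsum => m; apply: continuous_scale.
  exact: coordinate_continuous.
by apply: closed_equation; [exact: coordinate_continuous|exact: cst_continuous].
Qed.

Lemma window_vectors_submod : GRing.submod_closed [in window_vectors].
Proof.
split.
  rewrite inE; split=> // k j _; rewrite big1// => i _.
  by rewrite big1 ?mulr0// => m _; rewrite mulr0.
move=> c x y; rewrite !inE => -[xw x0] [yw y0]; split; last first.
  move=> j jw; transitivity (c * x j + y j) => //.
  by rewrite x0 ?y0// mulr0 addr0.
move=> k j kj; transitivity (c * x j + y j) => //.
rewrite (xw k j kj) (yw k j kj) mulr_sumr -big_split/=; apply: eq_bigr => i _.
rewrite mulrCA -mulrDr mulr_sumr -big_split/=; congr (_ * _).
by apply: eq_bigr => m _; rewrite mulrCA -mulrDr.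
Qed.

(** By induction on the coordinates: if x vanishes before a window, the block B_k
    sends its restriction to the prescribed coordinates of T_k x, which are zero,
    and x = R_k B_k x. *)
Lemma window_vectors_inj x : window_vectors x ->
  (forall k i, S k -> (i < L k)%N -> T k x i = 0) -> x = 0.
Proof.
move=> [xw x0] Tx0; apply/funext => j; elim/ltn_ind: j => j IH.
have [[k kj]|nw] := pselect (exists k, window k j); last first.
  by apply: x0 => k kj; apply: nw; exists k.
rewrite (xw k j kj) big1// => i _.
have [Sk /andP[akj _]] := kj.
have := Tx0 k i Sk (ltn_ord i); rewrite split_row//.
rewrite big_nat_cond big1 ?add0r; first by move=> ->; rewrite mulr0.
by move=> m /andP[/andP[_ mk] _]; rewrite IH ?mulr0//; lia.
Qed.

(** On the window of k, put x = R_k (z_k - the contribution of the coordinates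
    before the window to T_k x). This defines x recursively. *)
Lemma window_vectors_surj (z : nat -> nat -> K) :
  exists2 x, window_vectors x &
    forall k i, S k -> (i < L k)%N -> T k x i = z k i.
Proof.
have /choice[owner ownerP] : forall j, exists o : option nat,
    if o is Some k then window k j else forall k, ~ window k j.
  move=> j; have [[k kj]|nw] := pselect (exists k, window k j).
    by exists (Some k).
  by exists None => k kj; apply: nw; exists k.
have ownerE k j : window k j -> owner j = Some k.
  move=> kj; have := ownerP j; case: (owner j) => [k' k'j|/(_ k)//].
  by rewrite (window_inj kj k'j).
pose E j (x : nat -> K) := if owner j is Some k then
  \sum_(i < L k) r k i j *
    (z k i - \sum_(0 <= m < a k) entry (T k) i m * x m) else 0.
have [|x xE] := @triangular_system K 0 E.
  move=> j x y xy; rewrite /E; have := ownerP j.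
  case: (owner j) => // k [_ /andP[akj _]].
  apply: eq_bigr => i _; congr (_ * (_ - _)).
  by apply: eq_big_nat => m /andP[_ mk]; rewrite xy//; lia.
have win k i : S k -> (i < L k)%N ->
    \sum_(a k <= m < b k) entry (T k) i m * x m
    = z k i - \sum_(0 <= m < a k) entry (T k) i m * x m.
  move=> Sk iL.
  pose w i := z k i - \sum_(0 <= m < a k) entry (T k) i m * x m.
  rewrite -/(w i).
  transitivity (\sum_(a k <= m < b k) \sum_(i' < L k)
      entry (T k) i m * r k i' m * w i').
    apply: eq_big_nat => m mk; rewrite xE /E (ownerE k)// mulr_sumr.
    by apply: eq_bigr => i' _; rewrite mulrA.
  rewrite exchange_big/=.
  under eq_bigr => i' _ do rewrite -mulr_suml rP//.
  rewrite (bigD1 (Ordinal iL))//= eqxx mul1r big1 ?addr0// => i' i'i.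
  suff -> : (i == i' :> nat) = false by rewrite mul0r.
  by apply/negbTE; apply: contra i'i => /eqP e; apply/eqP/val_inj.
exists x.
  split=> [k j kj|j nw].
    rewrite xE /E (ownerE _ _ kj); have [Sk _] := kj.
    by apply: eq_bigr => i _; rewrite win.
  by rewrite xE /E; have := ownerP j; case: (owner j) => // k /nw.
by move=> k i Sk iL; rewrite split_row// win// addrC subrK.
Qed.

End Interpolation.

(** The subspace X is a closed complement of the space of those x for which all
    the prescribed coordinates vanish. *)
Lemma interpolation_subspace (K : numFieldType)
    (T : nat -> {linear omega K -> omega K}) (S : set nat) (d L : nat -> nat) :
  let f k := max_row_length (T k) (L k) in
  (forall k, S k -> continuous (T k)) ->
  (forall k, S k ->
    <<[seq \col_(i < L k) entry (T k) i j | j <- index_iota (d k) (f k)]>>%VS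
    = fullv :> {vspace 'cV[K]_(L k)}) ->
  (forall k k', S k -> S k' -> (k < k')%N -> (f k <= d k')%N) ->
  exists X : set (omega K), [/\ closed X, GRing.submod_closed [in X],
    forall x, X x ->
      (forall k i, S k -> (i < L k)%N -> T k x i = 0) -> x = 0
  & forall z : nat -> nat -> K, exists2 x, X x &
      forall k i, S k -> (i < L k)%N -> T k x i = z k i].
Proof.
move=> f T_cont full windows.
have /choice[r rP] : forall k, exists r : nat -> nat -> K, S k ->
    forall i i', (i < L k)%N -> (i' < L k)%N ->
    \sum_(d k <= j < f k) entry (T k) i' j * r i j = (i' == i)%:R.
  move=> k; have [Sk|nSk] := pselect (S k); last by exists (fun _ _ => 0).
  by have [r rP] := full_span_inverse (full k Sk); exists r.
have row_leq k i : S k -> (i < L k)%N -> (row_length (T k) i <= f k)%N.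
  by move=> _ iL; exact: (leq_bigmax (Ordinal iL)).
have rP' k i i' Sk := @rP k Sk i i'.
exists (window_vectors T S d f L r); split.
- exact: window_vectors_closed.
- exact: window_vectors_submod.
- exact: window_vectors_inj.
- exact: window_vectors_surj.
Qed.

(** * The frequently hypercyclic subspace *)

(** If n vectors spanned M, the identity matrix of size n+1, obtained by letting
    n+1 functionals act on suitable elements of M, would factor through
    dimension n. *)
Lemma infinite_dimensional_scalars (K : numFieldType) (V : lmodType K)
    (M : set V) (phi : nat -> V -> K) :
  (forall n, scalar (phi n)) ->
  (forall a : nat -> K, exists2 x, M x & forall n, phi n x = a n) ->
  infinite_dimensional M.
Proof.
move=> phi_lin phi_surj n v Mv.
have phiD m : {morph phi m : x y / x + y}.
  by move=> x y; have := phi_lin m 1 x y; rewrite scale1r mul1r.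
have phi0 m : phi m 0 = 0.
  by apply: (addrI (phi m 0)); rewrite -phiD !addr0.
have phiZ m a x : phi m (a *: x) = a * phi m x.
  by have := phi_lin m a x 0; rewrite phi0 !addr0.
have /choice[c cP] : forall m : 'I_n.+1, exists c : 'I_n -> K,
    forall m' : 'I_n.+1, \sum_(i < n) c i * phi m' (v i) = (m == m')%:R.
  move=> m; have [x /Mv[c _ <-] xP] := phi_surj (fun m' => (m == m' :> nat)%:R).
  exists c => m'; rewrite -[RHS](xP m') (big_morph _ (phiD m') (phi0 m')).
  by apply: eq_bigr => i _; rewrite phiZ.
have : (\matrix_(m < n.+1, i < n) c m i) *m (\matrix_(i < n, m < n.+1) phi m (v i))
    = 1%:M.
  apply/matrixP => m m'; rewrite !mxE -cP.
  by apply: eq_bigr => i _; rewrite !mxE.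
by move=> /mulmx1_min; rewrite ltnn.
Qed.

Theorem theorem4p13 (R : realType) (K : numFieldType)
    (hK : real_or_complex R K)
    (T : nat -> {linear omega K -> omega K})
    (T_cont : forall k, (1 <= k)%N -> continuous (T k))
    (d N : nat -> nat)
    (h_span : forall k l, (1 <= k)%N -> (1 <= l)%N ->
      <<[seq \col_(i < l) entry (T k) i j
           | j <- index_iota (d k) (max_row_length (T k) l)]>>%VS
      = fullv :> {vspace 'cV[K]_l})
    (h_sep : forall k l, (1 <= k)%N -> (1 <= l)%N ->
      forall k', (k + N l <= k')%N -> (max_row_length (T k) l <= d k')%N) :
  exists M : set (omega K), frequently_hypercyclic_subspace R (fun k => T k) M.
Proof.
have [D [D0 D_dense]] := dense_sequence hK.
pose task p : nat * seq nat := odflt (0%N, [::]) (unpickle p).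
have taskK t : task (pickle t) = t by rewrite /task pickleK.
pose c p := (task p).1.
(* One row more than the list, so that the task (n, [::]) has a row. Past the end
   of the list, nth returns 0 and the target is D 0 = 1: at the times of
   (n, [::]) the first coordinate is the multiplier itself. *)
pose l p := (size (task p).2).+1.
pose y p i := D (nth 0%N (task p).2 i).
have [h [h_gt0 h_le h_inj h_sepW]] := separated_progressions (fun p => N (l p)).
(* Interpolation counts prescribed coordinates by time, so tasks have to be
   recovered from their times. *)
have /choice[lab labP] : forall k, exists p, forall q s, h q s = k -> q = p.
  move=> k; have [[[p s] /= <-]|nh] := pselect (exists u, h u.1 u.2 = k).
    by exists p => q t /h_inj[].
  by exists 0%N => q s hk; case: nh; exists (q, s).
have lab_h p s : lab (h p s) = p by rewrite -(labP (h p s) p s).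
have [|||X [X_closed X_submod X_inj X_surj]] := @interpolation_subspace K T
    [set k | exists p s, h p s = k] d (fun k => l (lab k)).
- by move=> _ [p [s <-]]; exact: T_cont.
- by move=> _ [p [s <-]]; exact: h_span.
- move=> _ _ [p [s <-]] [q [t <-]] lt_h; apply: h_sep => //.
  by rewrite lab_h; exact: h_sepW.
pose coef (n : nat) (x : omega K) := T (h (pickle (n, [::] : seq nat)) 0%N) x 0%N.
pose M := [set x | X x /\ forall p s i, (i < l p)%N ->
  T (h p s) x i = coef (c p) x * y p i].
have coef_scalar n : scalar (coef n).
  by move=> a u v; rewrite /coef linearP.
have T_coord k i : (0 < k)%N -> continuous (fun x : omega K => T k x i).
  move=> k0 x; apply: (@continuous_comp _ _ _ (T k) (fun x : omega K => x i)).
    exact: T_cont.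
  exact: coordinate_continuous.
exists M; split.
- split.
    rewrite inE; split; first by have [/[!inE]] := X_submod.
    by move=> p s i il; rewrite /coef !linear0 mul0r.
  move=> a u v; rewrite !inE => -[Xu Mu] [Xv Mv]; split.
    have [_ H] := X_submod; have := H a u v.
    by rewrite !inE; apply.
  move=> p s i il; rewrite coef_scalar.
  transitivity (a * T (h p s) u i + T (h p s) v i); first by rewrite linearP.
  by rewrite Mu// Mv// mulrDl mulrA.
- apply: closedI => //; do 3 apply: closed_forall => ?.
  apply: closed_implies; apply: closed_equation; first exact: T_coord.
  under eq_fun do rewrite mulrC.
  by apply: continuous_scale; exact: T_coord.
- apply: (infinite_dimensional_scalars coef_scalar) => a.
  have [x Xx xP] := X_surj (fun k i => a (c (lab k)) * y (lab k) i).
  have xhP p s i : (i < l p)%N -> T (h p s) x i = a (c p) * y p i.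
    by move=> il; rewrite xP ?lab_h//; exists p, s.
  have coefE n : coef n x = a n.
    by rewrite /coef xhP// /c /y taskK/= D0 mulr1.
  by exists x => //; split=> // p s i il; rewrite coefE xhP.
- move=> x [Xx Mx] x_neq0.
  have [n an0] : exists n, coef n x != 0.
    apply: contrapT => /forallNP coef0; apply: x_neq0; apply: X_inj => //.
    move=> _ i [p [s <-]] il; rewrite Mx; last by rewrite lab_h in il.
    by have /negP/negPn/eqP -> := coef0 (c p); rewrite mul0r.
  move=> U U_open [u Uu].
  have [m [e [e0 mU]]] := open_omega_cylinder U_open Uu.
  (* Targets are met up to the factor coef n x, hence the rescaling. *)
  have e'0 : 0 < e / `|coef n x| by rewrite divr_gt0// normr_gt0.
  have /choice[q qP] i := D_dense ((coef n x)^-1 * u i) _ e'0.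
  pose p := pickle (n, mkseq q m).
  have [C hC] := h_le p.
  apply: (@lower_density_gt0 _ _ (h p) C).
  + by move=> s t /h_inj[].
  + by move=> s; rewrite h_gt0 hC.
  + move=> s; split; first exact: h_gt0.
    apply: mU => i im; rewrite Mx; last by rewrite /l taskK/= size_mkseq leqW.
    rewrite /c /y taskK/= nth_mkseq// distrC.
    by rewrite -[u i](mulVKf an0) -mulrBr normrM mulrC -ltr_pdivlMr ?normr_gt0.
Qed.
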